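(* Let $\pi$ be any permutation. Any non-adaptive one-sided $\varepsilon$-test for $\pi$-freeness has query complexity $\Omega\!\left(\varepsilon^{-1/u(\pi)} n^{1-1/u(\pi)}\right)$, where $u(\pi)$ is the unique signed partition number of $\pi$.
   Context: A permutation $\pi=(\pi_1,\dots,\pi_k)$ of $[k]$ is viewed as a sequence. A sequence $f\colon[N]\to\mathbb{R}$ contains $\pi$ if there are indices $i_1<\dots<i_k$ with $f(i_a)<f(i_b)$ iff $\pi_a<\pi_b$ for all $a,b$ (a $\pi$-copy); otherwise $f$ is $\pi$-free. $f\colon[n]\to\mathbb{R}$ is $\varepsilon$-far from $\pi$-freeness if more than $\varepsilon n$ values must be changed to make it $\pi$-free. A one-sided $\varepsilon$-test always accepts $\pi$-free inputs and rejects $\varepsilon$-far inputs with probability at least $2/3$; it is non-adaptive if all queries are chosen before any answer is seen. Hidden constants may depend on $k$. USPN. A consecutive subsequence of $\pi$ is $\pi[i,j]=(\pi_i,\dots,\pi_j)$. A partition $\Lambda=(\sigma_1,\dots,\sigma_\ell)$ of $\pi$ consists of consecutive subsequences $\sigma_1=\pi[1,r_1],\sigma_2=\pi[r_1+1,r_2],\dots,\sigma_\ell=\pi[r_{\ell-1}+1,k]$ (set $r_0=0$, $r_\ell=k$); its size is $\ell$. A signed partition $P=(\Lambda,S)$ adds a sign vector $S=(s_1,\dots,s_\ell)\in\{+,-\}^\ell$ such that for every $\sigma_i$ of length greater than one: if $\min\sigma_i$ appears before $\max\sigma_i$ in $\pi$ then $s_i=-$, otherwise $s_i=+$ (signs of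 length-one parts are arbitrary). Its size is $\ell$. Let $k_i=r_i-r_{i-1}$ be the length of $\sigma_i$. Define $f_P\colon[k^2]\to\mathbb{R}$ by: for $1\le i\le \ell$, $1\le j\le k_i$, $0\le m\le k-1$, $f_P(r_{i-1}k+mk_i+j)=m+\pi_{r_{i-1}+j}/(2k)$ if $s_i=+$, and $f_P(r_{i-1}k+mk_i+j)=(k-1-m)+\pi_{r_{i-1}+j}/(2k)$ if $s_i=-$. For each $0\le m\le k-1$ the set of entries $x$ with $m<f_P(x)<m+1$ forms a $\pi$-copy, called trivial. $P$ is unique if $f_P$ contains no non-trivial $\pi$-copy. The unique signed partition number $u(\pi)$ is the maximum size of a unique signed partition of $\pi$.
   Formalization: The bound is proved for permutations of length k ≥ 2 (for k = 1 it fails, since always rejecting is a valid 0-query test) and in the range ε ≤ ε₀(k) and εn ≥ 1, outside which it can fail (no ε-far inputs for ε near 1; the bound exceeds n when εn is far below 1). *)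

(* Defs.v *)
From HB Require Import structures.
From mathcomp Require Import all_boot all_order all_algebra all_fingroup.
From mathcomp Require Import all_classical all_reals all_analysis.

Set Implicit Arguments.
Unset Strict Implicit.
Unset Printing Implicit Defensive.

Import Order.TTheory GRing.Theory Num.Theory.

Local Open Scope classical_set_scope.
Local Open Scope ring_scope.

(* Positions and values are 0-based throughout: the permutation (pi_1 .. pi_k)
   of [k] is p : 'S_k with pi_(a+1) = (p a).+1, and [n] is 'I_n. *)

Section Patterns.
Variables (R : realType) (k : nat) (p : 'S_k).

Definition is_copy (N : nat) (f : 'I_N -> R) (g : 'I_k -> 'I_N) : Prop :=
  (forall a b : 'I_k, (a < b)%N -> (g a < g b)%N) /\
  (forall a b : 'I_k, f (g a) < f (g b) <-> (p a < p b)%N).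

Definition contains (N : nat) (f : 'I_N -> R) : Prop :=
  exists g : 'I_k -> 'I_N, is_copy f g.

Definition pattern_free (N : nat) (f : 'I_N -> R) : Prop := ~ contains f.

Definition eps_far (n : nat) (eps : R) (f : 'I_n -> R) : Prop :=
  forall g : 'I_n -> R, pattern_free g ->
    eps * n%:R < #|[set i : 'I_n | f i != g i]%SET|%:R.

End Patterns.

Section SignedPartitions.
Variables (k : nat) (p : 'S_k).

(* The part sigma_(i+1), i < sp_size, occupies the 0-based positions
   sp_cut i, ..., (sp_cut i.+1).-1; sp_plus i means that its sign is +.
   Values of sp_cut beyond sp_size and of sp_plus from sp_size on are
   irrelevant. *)
Record signed_partition := SignedPartition {
  sp_size : nat;
  sp_cut : nat -> nat;
  sp_plus : nat -> bool;
  sp_cut_first : sp_cut 0 = 0%N;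
  sp_cut_last : sp_cut sp_size = k;
  sp_cut_lt : forall i, (i < sp_size)%N -> (sp_cut i < sp_cut i.+1)%N;
  sp_sign : forall (i : nat) (a b : 'I_k),
    (i < sp_size)%N -> (1 < sp_cut i.+1 - sp_cut i)%N ->
    (sp_cut i <= a < sp_cut i.+1)%N -> (sp_cut i <= b < sp_cut i.+1)%N ->
    (* p a = min sigma_(i+1) and p b = max sigma_(i+1) *)
    (forall c : 'I_k, (sp_cut i <= c < sp_cut i.+1)%N -> (p a <= p c <= p b)%N) ->
    sp_plus i = ~~ (a < b)%N
}.

Definition sp_len (P : signed_partition) (i : nat) : nat :=
  (sp_cut P i.+1 - sp_cut P i)%N.

(* The part in whose block [r_i k, r_(i+1) k) of [k^2] the index x lies. *)
Definition sp_part (P : signed_partition) (x : nat) : nat :=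
  find (fun i => x < sp_cut P i.+1 * k)%N (iota 0 (sp_size P)).

(* The 1-based value pi_(a+1); 0 if a >= k. *)
Definition entry (a : nat) : nat :=
  if insub a is Some j then (p (j : 'I_k)).+1 else 0%N.

Variable R : realType.

Definition sp_seq_value (P : signed_partition) (i m j : nat) : R :=
  (if sp_plus P i then m else (k.-1 - m)%N)%:R
  + (entry (sp_cut P i + j))%:R / (2 * k)%:R.

(* f_P; lemma sp_seqE below is its defining formula. *)
Definition sp_seq (P : signed_partition) (x : 'I_(k ^ 2)) : R :=
  let i := sp_part P x in
  let y := (x - sp_cut P i * k)%N in
  sp_seq_value P i (y %/ sp_len P i) (y %% sp_len P i).

Definition is_trivial_copy (P : signed_partition) (g : 'I_k -> 'I_(k ^ 2)) :
    Prop :=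
  exists m : 'I_k, forall x : 'I_(k ^ 2),
    (exists a, g a = x) <-> m%:R < sp_seq P x < m.+1%:R.

Definition unique_sp (P : signed_partition) : Prop :=
  forall g : 'I_k -> 'I_(k ^ 2), is_copy p (sp_seq P) g -> is_trivial_copy P g.

(* u(pi). Parts are nonempty, so sizes are at most k and the range of the
   maximum is no restriction. *)
Definition uspn : nat :=
  \max_(l < k.+1 |
        `[< exists P : signed_partition, sp_size P = l /\ unique_sp P >]) l.

End SignedPartitions.

Lemma sp_cut_le (k : nat) (p : 'S_k) (P : signed_partition p) (i j : nat) :
  (i <= j <= sp_size P)%N -> (sp_cut P i <= sp_cut P j)%N.
Proof.
elim: j => [|j IH]; first by rewrite leqn0 => /andP[/eqP->].
case/andP; rewrite leq_eqVlt => /orP[/eqP-> //|ij] jl.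
apply: leq_trans (ltnW (sp_cut_lt jl)); apply: IH.
by rewrite -ltnS ij ltnW.
Qed.

Lemma sp_seqE (k : nat) (p : 'S_k) (R : realType) (P : signed_partition p)
    (i m j : nat) (x : 'I_(k ^ 2)) :
  (i < sp_size P)%N -> (m < k)%N -> (j < sp_len P i)%N ->
  x = (sp_cut P i * k + m * sp_len P i + j)%N :> nat ->
  sp_seq R P x = sp_seq_value R P i m j.
Proof.
move=> il mk jk xE.
have len_gt0 : (0 < sp_len P i)%N by apply: leq_ltn_trans jk.
have cutS : sp_cut P i.+1 = (sp_cut P i + sp_len P i)%N.
  by rewrite /sp_len subnKC // ltnW // sp_cut_lt.
have x_lt : (x < sp_cut P i.+1 * k)%N.
  rewrite xE cutS mulnDl -addnA ltn_add2l (mulnC _ k).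
  apply: (@leq_trans (m.+1 * sp_len P i)); last by rewrite leq_mul2r mk orbT.
  by rewrite mulSn addnC ltn_add2r.
have partE : sp_part P x = i.
  rewrite /sp_part; apply/eqP; rewrite eqn_leq; apply/andP; split.
    rewrite leqNgt; apply/negP => /(before_find 0%N).
    by rewrite nth_iota // add0n x_lt.
  set a := (fun i : nat => _); set s := iota _ _.
  have hs : has a s by apply/hasP; exists i; rewrite ?mem_iota.
  have := nth_find 0%N hs; rewrite leqNgt.
  have fl : (find a s < sp_size P)%N by move: hs; rewrite has_find size_iota.
  rewrite nth_iota // add0n /a => xl; apply/negP => fi.
  have : (sp_cut P (find a s).+1 * k <= sp_cut P i * k)%N.
    by rewrite leq_mul2r sp_cut_le ?orbT // fi ltnW.
  by move/(leq_trans xl); rewrite xE -addnA ltnNge leq_addr.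
rewrite /sp_seq partE xE -addnA addKn.
by rewrite divnMDl // divn_small // addn0 modnMDl modn_small.
Qed.

(* A non-adaptive randomized algorithm on inputs f : [n] -> R, with internal
   randomness w drawn from T: the queried set depends on w only, and the
   decision depends on w and the values of f on the queried set. *)
Record nonadaptive_alg (R : realType) (n : nat) (d : measure_display)
    (T : measurableType d) := NonadaptiveAlg {
  alg_query : T -> {set 'I_n};
  alg_accept : T -> ('I_n -> R) -> bool;
  alg_local : forall (w : T) (f g : 'I_n -> R),
    (forall i, i \in alg_query w -> f i = g i) ->
    alg_accept w f = alg_accept w g;
  alg_query_measurable : forall A : {set 'I_n},
    measurable [set w | alg_query w = A];
  alg_accept_measurable : forall f : 'I_n -> R,
    measurable [set w | alg_accept w f]
}.

Definition one_sided_test (R : realType) (k : nat) (p : 'S_k) (n : nat)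
    (eps : R) (d : measure_display) (T : measurableType d)
    (Pr : probability T R) (t : nonadaptive_alg R n T) : Prop :=
  (forall f : 'I_n -> R, pattern_free p f ->
     Pr [set w | alg_accept t w f] = 1%:E) /\
  (forall f : 'I_n -> R, eps_far p eps f ->
     ((2 / 3)%:E <= Pr [set w | ~~ alg_accept t w f])%E).

Definition query_bound (R : realType) (n : nat) (d : measure_display)
    (T : measurableType d) (t : nonadaptive_alg R n T) (q : nat) : Prop :=
  forall w : T, (#|alg_query t w| <= q)%N.

(* Main.v *)
Require Import Defs.
From HB Require Import structures.
From mathcomp Require Import all_boot all_order all_algebra all_fingroup.
From mathcomp Require Import all_classical all_reals all_analysis.
From mathcomp Require Import zify ring lra.

Set Implicit Arguments.
Unset Strict Implicit.
Unset Printing Implicit Defensive.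

Import Order.TTheory GRing.Theory Num.Theory.
Local Open Scope ring_scope.

(** Let P be a unique signed partition of size l = u(pi). Stretch f_P to l
    blocks of D = Theta(n) chunks each, where the i-th block lists, in the
    direction given by its sign, chunks sigma_i at heights t_i, t_i + 1, ...
    for a random shift t_i < D / 2. Chunks of different blocks are put on a
    common level exactly when they have the same height and this height is a
    multiple of h = Theta(1 / eps). Since a copy of pi meets at most k levels,
    uniqueness of P forces every copy onto a single common level. There are
    more than eps n such levels, each carrying a copy, so the input is
    eps-far. On the other hand, a query set A contains a copy only if the
    shifts are determined by one point of A per block and a common height,
    which happens for at most |A|^l * O(D / h) of the (D / 2)^l shifts. As a
    one-sided test can only reject when it sees a copy, averaging over the
    shifts gives q^l = Omega(h D^(l-1)). *)

(** * Comparing values of the form level plus entry over [2 * k] *)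

Section Values.
Variables (R : realType) (k : nat).
Hypothesis k_gt0 : (0 < k)%N.

Lemma level_lt (m e m' e' : nat) : (m < m')%N -> (e <= k)%N -> (0 < e')%N ->
  (2 * k * m + e < 2 * k * m' + e')%N.
Proof. by nia. Qed.

(** Scaling by [2 * k] makes both sides integers, so that comparisons of values reduce to
    natural-number arithmetic. *)
Lemma lt_level_value (m e m' e' : nat) :
  (m%:R + e%:R / (2 * k)%:R < m'%:R + e'%:R / (2 * k)%:R :> R) =
  (2 * k * m + e < 2 * k * m' + e')%N.
Proof.
have K : 0 < (2 * k)%:R :> R by rewrite ltr0n; lia.
rewrite -(ltr_pM2r K) !mulrDl !divfK ?gt_eqF // -!natrM -!natrD ltr_nat.
by rewrite ![(_ * (2 * k))%N]mulnC.
Qed.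

Lemma level_value_between (M m e : nat) : (e <= k)%N ->
  M%:R < m%:R + e%:R / (2 * k)%:R :> R ->
  m%:R + e%:R / (2 * k)%:R < M.+1%:R :> R -> m = M.
Proof.
move=> ek; have E (z : nat) : z%:R = z%:R + 0%:R / (2 * k)%:R :> R.
  by rewrite mul0r addr0.
by rewrite (E M) (E M.+1) !lt_level_value; nia.
Qed.

Lemma between_level_value (m e : nat) : (0 < e <= k)%N ->
  m%:R < (m%:R + e%:R / (2 * k)%:R : R) < m.+1%:R.
Proof.
move=> ek; have E (z : nat) : z%:R = z%:R + 0%:R / (2 * k)%:R :> R.
  by rewrite mul0r addr0.
by rewrite {1}(E m) (E m.+1) !lt_level_value; nia.
Qed.

End Values.

Section Copies.
Variables (R : realType) (k : nat) (p : 'S_k).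

Lemma entry_ord (a : 'I_k) : entry p a = (p a).+1.
Proof. by rewrite /entry valK. Qed.

Lemma entry_bounds (a : nat) : (a < k)%N -> (0 < entry p a <= k)%N.
Proof. by move=> ak; have := entry_ord (Ordinal ak) => /= ->; rewrite /= ltn_ord. Qed.

(** Since [p] is injective, one of the two strict inequalities between [p a] and [p b] holds and
    transfers to the values. *)
Lemma copy_neq (N : nat) (f : 'I_N -> R) (g : 'I_k -> 'I_N) (a b : 'I_k) :
  is_copy p f g -> a != b -> f (g a) != f (g b).
Proof.
move=> [_ gv]; apply: contraNneq => e; apply/eqP.
apply: (@perm_inj _ p); apply/val_inj/eqP => /=.
have := gv a b; have := gv b a; rewrite e ltxx.
by case: ltngtP => // _ [? h1] [? h2]; [have := h1 isT | have := h2 isT].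
Qed.

End Copies.

(** * Copies in stretched versions of the sequence of a unique signed partition *)

Section Collapse.
Variables (R : realType) (k : nat) (p : 'S_k) (P : signed_partition p).
Hypothesis P_unique : unique_sp R P.

Lemma sp_cutS (i : nat) : (i < sp_size P)%N ->
  sp_cut P i.+1 = (sp_cut P i + sp_len P i)%N.
Proof. by move=> il; rewrite /sp_len subnKC // ltnW // sp_cut_lt. Qed.

Lemma sp_cutS_le (i : nat) : (i < sp_size P)%N -> (sp_cut P i.+1 <= k)%N.
Proof.
move=> il; rewrite -[k in X in (_ <= X)%N](sp_cut_last P).
by rewrite sp_cut_le // il leqnn.
Qed.

Lemma sp_len_gt0 (i : nat) : (i < sp_size P)%N -> (0 < sp_len P i)%N.
Proof. by move=> il; rewrite subn_gt0 sp_cut_lt. Qed.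

Lemma block_index_ub (i m j : nat) :
  (i < sp_size P)%N -> (m < k)%N -> (j < sp_len P i)%N ->
  (sp_cut P i * k + m * sp_len P i + j < sp_cut P i.+1 * k)%N.
Proof. by move=> il mk jl; rewrite sp_cutS //; nia. Qed.

Lemma block_index_lt (i m j : nat) :
  (i < sp_size P)%N -> (m < k)%N -> (j < sp_len P i)%N ->
  (sp_cut P i * k + m * sp_len P i + j < k ^ 2)%N.
Proof.
move=> il mk jl; apply: leq_trans (block_index_ub il mk jl) _.
by rewrite -mulnn leq_mul2r sp_cutS_le // orbT.
Qed.

Lemma block_index_lt_part (i m j i' m' j' : nat) :
  (i < i')%N -> (i' < sp_size P)%N -> (m < k)%N -> (j < sp_len P i)%N ->
  (sp_cut P i * k + m * sp_len P i + j <
   sp_cut P i' * k + m' * sp_len P i' + j')%N.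
Proof.
move=> ii' il' mk jl.
apply: leq_trans (block_index_ub (ltn_trans ii' il') mk jl) _.
rewrite -addnA; apply: leq_trans (leq_addr _ _).
by rewrite leq_mul2r sp_cut_le ?orbT // ii' ltnW.
Qed.

(** Row of block [i] that lies on level [v]. Being an involution below [k], it also sends a row to
    its level. *)
Definition level_pos (i v : nat) : nat := if sp_plus P i then v else (k.-1 - v)%N.

Lemma level_posK (i v : nat) : (v < k)%N -> level_pos i (level_pos i v) = v.
Proof. by rewrite /level_pos; case: sp_plus => // vk; lia. Qed.

Lemma level_pos_lt (i v : nat) : (v < k)%N -> (level_pos i v < k)%N.
Proof. by rewrite /level_pos; case: sp_plus => // vk; lia. Qed.

Lemma sp_seq_level (i v j : nat) (x : 'I_(k ^ 2)) :
  (i < sp_size P)%N -> (v < k)%N -> (j < sp_len P i)%N ->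
  x = (sp_cut P i * k + level_pos i v * sp_len P i + j)%N :> nat ->
  sp_seq R P x = v%:R + (entry p (sp_cut P i + j))%:R / (2 * k)%:R.
Proof.
move=> il vk jl xE; rewrite (sp_seqE R il (level_pos_lt i vk) jl xE).
by rewrite /sp_seq_value -/(level_pos i _) level_posK.
Qed.

(** A sequence in coordinates: each block runs through its levels in the direction of its sign, with
    no bound on their number. Weak monotonicity of [off] permits repeated values. *)
Variables (N : nat) (part level off : 'I_N -> nat) (f : 'I_N -> R).
Hypothesis part_lt : forall x, (part x < sp_size P)%N.
Hypothesis off_lt : forall x, (off x < sp_len P (part x))%N.
Hypothesis fE : forall x,
  f x = (level x)%:R + (entry p (sp_cut P (part x) + off x))%:R / (2 * k)%:R.
Hypothesis lex : forall x x' : 'I_N, (x < x')%N ->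
  (part x < part x')%N \/
  part x = part x' /\
  ((if sp_plus P (part x) then level x < level x' else level x' < level x)%N \/
   level x = level x' /\ (off x <= off x')%N).

(* At most k levels occur in a copy, so replacing each level by its rank among
   them moves the copy into f_P, where uniqueness applies. *)
Lemma copy_collapse (g : 'I_k -> 'I_N) : is_copy p f g ->
  (forall a b, level (g a) = level (g b)) /\
  (forall i, (i < sp_size P)%N -> exists a, part (g a) = i).
Proof.
move=> gcopy; have [gp gv] := gcopy.
have k_gt0 (a : 'I_k) : (0 < k)%N := leq_ltn_trans (leq0n a) (ltn_ord a).
pose rk (a : 'I_k) := #|[set b | level (g b) < level (g a)]%N%SET|.
(* The rank is below [k] because [a] does not count itself. *)
have rk_lt a : (rk a < k)%N.
  rewrite -[X in (_ < X)%N]card_ord -cardsT; apply: proper_card.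
  apply/properP; split; first exact: finset.subsetT.
  by exists a; rewrite ?inE // ltnn.
have rk_mono a b : (level (g a) < level (g b))%N -> (rk a < rk b)%N.
  move=> ab; apply: proper_card; apply/properP; split.
    by apply/fintype.subsetP => c; rewrite !inE => /ltn_trans; apply.
  by exists a; rewrite inE ?ltnn.
have rk_eq a b : level (g a) = level (g b) -> rk a = rk b.
  by rewrite /rk => ->.
have entry_le a : (0 < entry p (sp_cut P (part (g a)) + off (g a)) <= k)%N.
  apply: entry_bounds; have := sp_cutS_le (part_lt (g a)).
  by rewrite sp_cutS //; apply: leq_trans; rewrite ltn_add2l.
(* Each entry keeps its part and offset; only its level is replaced by the rank. *)
pose G a : 'I_(k ^ 2) := Ordinal
  (block_index_lt (part_lt (g a)) (level_pos_lt (part (g a)) (rk_lt a))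
     (off_lt (g a))).
have GE a : sp_seq R P (G a) =
    (rk a)%:R + (entry p (sp_cut P (part (g a)) + off (g a)))%:R / (2 * k)%:R.
  exact: (@sp_seq_level (part (g a)) (rk a) (off (g a))).
have Gcopy : is_copy p (sp_seq R P) G.
  split=> a b.
    move=> ab; have := lex (gp _ _ ab) => -[|[Ep]].
      by move=> lt_ab; apply: block_index_lt_part; rewrite ?level_pos_lt.
    have := part_lt (g a); have := part_lt (g b).
    have := off_lt (g a); have := off_lt (g b).
    rewrite /= -Ep => ob oa _ pl [|[El Eo]].
      rewrite /level_pos; have := rk_lt a; have := rk_lt b.
      by case: sp_plus => ? ? /rk_mono; nia.
    have neq : off (g a) != off (g b).
      have := @copy_neq R k p N f g a b gcopy; rewrite -val_eqE neq_ltn ab => /(_ isT).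
      by apply: contra => /eqP e; rewrite !fE El Ep e.
    by rewrite (rk_eq _ _ El) ltn_add2l ltn_neqAle neq.
  apply: iff_trans (gv a b); rewrite !GE !fE !lt_level_value ?(k_gt0 a) //.
  have k0 := k_gt0 a.
  case/andP: (entry_le a) => ea0 ea; case/andP: (entry_le b) => eb0 eb.
  case: (ltngtP (level (g a)) (level (g b))) => [lt_l|lt_l|e].
  - by rewrite !level_lt ?rk_mono.
  - have lt1 := level_lt k0 (rk_mono _ _ lt_l) eb ea0.
    have lt2 := level_lt k0 lt_l eb ea0.
    by split=> /ltnW; rewrite leqNgt ?lt1 ?lt2.
  - by rewrite (rk_eq _ _ e) e !ltn_add2l.
have [m trivm] := P_unique Gcopy.
have rkm a : rk a = m.
  have /trivm : exists b, G b = G a by exists a.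
  rewrite GE => /andP[]; apply: level_value_between; first exact: k_gt0 a.
  by have := entry_le a; lia.
split=> [a b|i il].
  by case: (ltngtP (level (g a)) (level (g b))) => // /rk_mono; rewrite !rkm ltnn.
(* The first entry of part [i] on level [m] belongs to the trivial copy, hence is some [G a]; blocks
   are disjoint intervals, so [a] has part [i]. *)
have pos_lt := block_index_lt il (level_pos_lt i (ltn_ord m)) (sp_len_gt0 il).
have /trivm [a Ga] : m%:R < sp_seq R P (Ordinal pos_lt) < m.+1%:R.
  rewrite (@sp_seq_level i m 0 _ il (ltn_ord m) (sp_len_gt0 il)) //.
  apply: between_level_value; first exact: k_gt0 m.
  apply: entry_bounds; rewrite addn0; apply: leq_trans (sp_cutS_le il).
  exact: sp_cut_lt.
exists a; have [] // := ltngtP (part (g a)) i => h.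
  have := block_index_lt_part (level_pos i m) 0 h il
    (level_pos_lt (part (g a)) (rk_lt a)) (off_lt (g a)).
  by have := congr1 val Ga => /= ->; rewrite ltnn.
have := block_index_lt_part (level_pos (part (g a)) (rk a)) (off (g a)) h
  (part_lt _) (level_pos_lt i (ltn_ord m)) (sp_len_gt0 il).
by have := congr1 val Ga => /= ->; rewrite ltnn.
Qed.

End Collapse.

(** * The unique signed partition number is attained *)

Section OnePart.
Variables (R : realType) (k : nat) (p : 'S_k).
Hypothesis k_gt1 : (1 < k)%N.

(* The sign is chosen so that the order of the k copies of pi in f_P disagrees
   with the order of the minimum and the maximum of pi; hence in any copy both
   of these, and so all entries, lie on one level. *)
Lemma one_part_unique : exists P : signed_partition p,
  sp_size P = 1%N /\ unique_sp R P.
Proof.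
have k_gt0 : (0 < k)%N by exact: ltnW.
have last_lt : (k.-1 < k)%N by rewrite prednK.
pose a0 := (p^-1)%g (Ordinal k_gt0); pose b0 := (p^-1)%g (Ordinal last_lt).
have pa0 : p a0 = 0%N :> nat by rewrite permKV.
have pb0 : p b0 = k.-1 :> nat by rewrite permKV.
have pb0_max c : (p c <= p b0)%N by rewrite pb0; have := ltn_ord (p c); lia.
have ab0 : a0 != b0.
  by apply/eqP => e; move: pb0; rewrite -e pa0; lia.
have cut_last : (1 * k)%N = k by rewrite mul1n.
have cut_lt i : (i < 1)%N -> (i * k < i.+1 * k)%N by rewrite mulSn; lia.
have sign (i : nat) (a b : 'I_k) : (i < 1)%N -> (1 < i.+1 * k - i * k)%N ->
    (i * k <= a < i.+1 * k)%N -> (i * k <= b < i.+1 * k)%N ->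
    (forall c : 'I_k, (i * k <= c < i.+1 * k)%N -> (p a <= p c <= p b)%N) ->
    ~~ (a0 < b0)%N = ~~ (a < b)%N.
  case: i => // _ _ _ _ H.
  have -> : a0 = a.
    apply: (@perm_inj _ p); apply: val_inj; rewrite /= pa0.
    by have := H a0; rewrite mul0n mul1n ltn_ord pa0 => /(_ isT); lia.
  have -> // : b0 = b.
  apply: (@perm_inj _ p); apply: val_inj; rewrite /=.
  have := H b0; rewrite mul0n mul1n ltn_ord => /(_ isT).
  by have := pb0_max b; lia.
pose P := @SignedPartition k p 1 (muln^~ k) (fun=> ~~ (a0 < b0)%N)
  (mul0n k) cut_last cut_lt sign.
exists P; split=> // g gcopy; have [gp gv] := gcopy.
have lenE : sp_len P 0 = k by rewrite /sp_len /= mul0n subn0 mul1n.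
have divk (x : 'I_(k ^ 2)) : (x %/ k < k)%N.
  by rewrite ltn_divLR // mulnn.
pose lev (x : 'I_(k ^ 2)) := level_pos P 0 (x %/ k).
have entry_ub (x : 'I_(k ^ 2)) : (0 < entry p (x %% k) <= k)%N.
  by rewrite entry_bounds // ltn_mod.
have fE x : sp_seq R P x = (lev x)%:R + (entry p (x %% k))%:R / (2 * k)%:R.
  rewrite (@sp_seq_level R k p P 0 (lev x) (x %% k)) //.
  - exact: level_pos_lt.
  - by rewrite lenE ltn_mod.
  - by rewrite level_posK // lenE /= mul0n add0n -divn_eq.
have lev_le a b : (p a <= p b)%N -> (lev (g a) <= lev (g b))%N.
  rewrite leq_eqVlt => /orP[/eqP e|/gv].
    by have -> : a = b by apply: (@perm_inj _ p); apply: val_inj.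
  rewrite !fE lt_level_value // => lt_ab; rewrite leqNgt; apply/negP => lt_lev.
  have := level_lt k_gt0 lt_lev; have /andP[_ e1] := entry_ub (g b).
  have /andP[e2 _] := entry_ub (g a) => /(_ _ _ e1 e2) /ltnW.
  by rewrite leqNgt lt_ab.
(* The sign enters here: if the minimum comes first the levels descend along the sequence, otherwise
   they ascend. Together with [lev_le] this forces equality. *)
have lev_ba : (lev (g b0) <= lev (g a0))%N.
  have q_le (a b : 'I_k) : (a < b)%N -> (g a %/ k <= g b %/ k)%N.
    by move=> /gp /ltnW; apply: leq_div2r.
  rewrite /lev /level_pos /=; case: (ltngtP a0 b0) => [/q_le|/q_le //|/val_inj e] /=.
    by move=> ?; apply: leq_sub2l.
  by rewrite e eqxx in ab0.
have lev_const c : lev (g c) = lev (g a0).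
  apply/eqP; rewrite eqn_leq (leq_trans (lev_le _ _ (pb0_max c))) //=.
  by apply: lev_le; rewrite pa0.
have q_const a b : (g a %/ k = g b %/ k)%N.
  rewrite -(@level_posK k p P 0 (g a %/ k)) // -(@level_posK k p P 0 (g b %/ k)) //.
  by rewrite -!/(lev _) !lev_const.
have lev_lt x : (lev x < k)%N by apply: level_pos_lt.
exists (Ordinal (lev_lt (g a0))) => x /=; split.
  case=> a <-; rewrite fE lev_const; exact: between_level_value.
rewrite fE => /andP[lt1 lt2].
have /andP[_ ex] := entry_ub x.
have lx := level_value_between k_gt0 ex lt1 lt2.
have qx a : (g a %/ k = x %/ k)%N.
  rewrite -(@level_posK k p P 0 (g a %/ k)) // -(@level_posK k p P 0 (x %/ k)) //.
  by rewrite -!/(lev _) lev_const lx.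
(* Within one row the [k] points of the copy have distinct residues modulo [k], so they fill the
   whole row. *)
pose u (a : 'I_k) : 'I_k := Ordinal (ltn_pmod (g a) k_gt0).
have u_inj : injective u.
  move=> a b /(congr1 val) /= e; apply: contra_eq (erefl (sp_seq R P (g a))) => ab.
  have := copy_neq gcopy ab.
  suff -> : g a = g b by rewrite eqxx.
  by apply: val_inj; rewrite /= (divn_eq (g a) k) (divn_eq (g b) k) (q_const a b) e.
exists (invF u_inj (Ordinal (ltn_pmod x k_gt0))).
have /(congr1 val) /= e := f_invF u_inj (Ordinal (ltn_pmod x k_gt0)).
by apply: val_inj; rewrite /= [LHS](divn_eq _ k) qx e -divn_eq.
Qed.

(** A maximum over an empty range would be 0 with no partition behind it; the one-part partition
    rules this out. *)
Lemma uspn_unique : exists P : signed_partition p,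
  sp_size P = uspn p R /\ unique_sp R P.
Proof.
have [P1 [s1 u1]] := one_part_unique.
pose A := [pred l : 'I_k.+1 | `[< exists P : signed_partition p,
  sp_size P = l /\ unique_sp R P >]].
have A_gt0 : (0 < #|A|)%N.
  have k1 : (1 < k.+1)%N by lia.
  by apply/card_gt0P; exists (Ordinal k1); apply/asboolP; exists P1.
have [l /asboolP [P [sP uP]] le] := eq_bigmax_cond (@nat_of_ord k.+1) A_gt0.
by exists P; split=> //; rewrite sP -le.
Qed.

End OnePart.

(** * Extending queried values without creating a copy *)

Section Extension.
Variables (R : realType) (k : nat) (p : 'S_k) (n : nat).
Implicit Types (f : 'I_n -> R) (A : {set 'I_n}).
Hypothesis k_gt1 : (1 < k)%N.

Definition copy_in f A : Prop :=
  exists g : 'I_k -> 'I_n, is_copy p f g /\ forall a, g a \in A.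

Lemma copy_comp f (r : 'I_n -> 'I_n) (g : 'I_k -> 'I_n) :
  (forall x y : 'I_n, (x <= y)%N -> (r x <= r y)%N) ->
  is_copy p (f \o r) g -> is_copy p f (r \o g).
Proof.
move=> r_mono gcopy; have [gp gv] := gcopy; split=> // a b ab.
rewrite ltn_neqAle r_mono ?andbT; last by rewrite ltnW ?gp.
have neq : a != b by rewrite -val_eqE /= ltn_eqF.
apply: contra (copy_neq gcopy neq) => /eqP /val_inj e.
by move: e; rewrite /= => ->.
Qed.

(** Send [x] to the largest element of [A] that is at most [x], or to the minimum of [A] if there is
    none. *)
Lemma monotone_retraction A : A != finset.set0 ->
  exists r : 'I_n -> 'I_n,
    [/\ forall x y : 'I_n, (x <= y)%N -> (r x <= r y)%N,
        forall x, r x \in A & forall x, x \in A -> r x = x].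
Proof.
case/finset.set0Pn => x0 x0A.
have low (x : 'I_n) : exists z, z \in A /\ if [exists z in A, (z <= x)%N]
    then (z <= x)%N /\ (forall y, y \in A -> (y <= x)%N -> (y <= z)%N)
    else forall y, y \in A -> (z <= y)%N.
  case: (boolP [exists z in A, (z <= x)%N]) => [/existsP[z /andP[zA zx]]|_].
    have Pz : (z \in A) && (z <= x)%N by rewrite zA.
    case: (@arg_maxnP _ z (fun y => (y \in A) && (y <= x)%N) (@nat_of_ord n) Pz).
    move=> y /andP[yA yx] ymax; exists y; split=> //; split=> // u uA ux.
    by apply: ymax; rewrite uA.
  case: (@arg_minnP _ x0 (mem A) (@nat_of_ord n) x0A) => y yA ymin.
  by exists y.
have [r rP] := boolp.choice low.
exists r; split=> [x y xy|x|x xA].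
- have [_ ry] := rP y; have [rxA rx] := rP x; move: rx ry.
  case: ifP => [_ [rxx _]|_ rmin _].
    have ex : [exists z in A, (z <= y)%N].
      by apply/existsP; exists (r x); rewrite rxA (leq_trans rxx).
    by rewrite ex => -[_]; apply=> //; apply: leq_trans rxx xy.
  by apply: rmin; case: (rP y).
- by case: (rP x).
- have [rxA] := rP x; have -> : [exists z in A, (z <= x)%N].
    by apply/existsP; exists x; rewrite xA leqnn.
  by case=> h1 /(_ x xA (leqnn _)) h2; apply: val_inj; apply/eqP; rewrite eqn_leq h1.
Qed.

(** Precompose [f] with a monotone retraction onto [A]: a copy in the result is pushed forward to a
    copy inside [A]. For empty [A] a constant works, as [k] is at least 2. *)
Lemma pattern_free_extension f A : ~ copy_in f A ->
  exists2 f', pattern_free p f' & forall x, x \in A -> f x = f' x.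
Proof.
move=> free.
have [A0|/monotone_retraction [r [r_mono rA rid]]] := eqVneq A finset.set0.
  exists (fun=> 0) => [[g gcopy]|x]; last by rewrite A0 inE.
  have := @copy_neq R k p n _ g (Ordinal (ltnW k_gt1)) (Ordinal k_gt1) gcopy isT.
  by rewrite eqxx.
exists (f \o r) => [[g /(copy_comp r_mono) gcopy]|x /rid /= -> //].
by apply: free; exists (r \o g); split=> // a; apply: rA.
Qed.

End Extension.

(** * From a randomized test to one query set that hits many inputs *)

Section Averaging.
Variables (R : realType) (k : nat) (p : 'S_k) (n : nat) (eps : R).
Variables (d : measure_display) (T : measurableType d) (Pr : probability T R).
Variables (t : nonadaptive_alg R n T).
Hypothesis k_gt1 : (1 < k)%N.
Hypothesis test : one_sided_test p eps Pr t.

Definition query_prob (A : {set 'I_n}) : R :=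
  fine (Pr [set w | alg_query t w = A]%classic).

Lemma query_probE (A : {set 'I_n}) :
  Pr [set w | alg_query t w = A]%classic = (query_prob A)%:E.
Proof.
by rewrite fineK // fin_num_measure //; apply: alg_query_measurable.
Qed.

Lemma fsbig_finType (I : finType) (F : I -> \bar R) :
  (\sum_(i \in [set: I]%classic) F i = \sum_(i : I) F i)%E.
Proof.
rewrite (fsbigE (enum I)) ?enum_uniq //; last by move=> i; rewrite mem_enum.
by rewrite big_enum_cond; apply: eq_bigl => i; rewrite in_setT.
Qed.

Lemma sum_query_prob : \sum_A query_prob A = 1.
Proof.
apply: EFin_inj; rewrite -sumEFin -fsbig_finType.
under eq_fsbigr => A _ do rewrite -query_probE.
rewrite -measure_fin_bigcup //.
- rewrite -[RHS](probability_setT Pr); congr (Pr _).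
  by apply/seteqP; split=> // w _; exists (alg_query t w).
- exact: finite_finset.
- by move=> A B _ _ [w [/= <- <-]].
- by move=> A _; apply: alg_query_measurable.
Qed.

(* If the queried values contain no copy, they extend to a pattern-free input,
   which the test accepts almost surely. *)
Lemma far_hit_prob (f : 'I_n -> R) : eps_far p eps f ->
  2 / 3 <= \sum_(A | `[< copy_in p f A >]) query_prob A.
Proof.
case: test => acc rej /rej; rewrite -lee_fin => /le_trans; apply.
have ext (A : {set 'I_n}) : exists f', ~ copy_in p f A ->
    pattern_free p f' /\ forall x, x \in A -> f x = f' x.
  case: (pselect (copy_in p f A)) => [c|nc]; first by exists f.
  by have [f' ? ?] := pattern_free_extension k_gt1 nc; exists f'.
have [e eP] := boolp.choice ext.
(* These events cover the rejection of [f]: after querying a copy-free [A], rejecting [f] means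
   rejecting its pattern-free extension [e A], a null event. *)
pose S A := if `[< copy_in p f A >] then [set w | alg_query t w = A]%classic
            else [set w | ~~ alg_accept t w (e A)]%classic.
have rej_meas f' : measurable [set w | ~~ alg_accept t w f']%classic.
  rewrite (_ : [set _ | _]%classic = ~` [set w | alg_accept t w f'])%classic.
    exact/measurableC/alg_accept_measurable.
  by apply/seteqP; split=> w /= /negP.
apply: le_trans (_ : (_ <= \sum_(A \in [set: {set 'I_n}]%classic) Pr (S A))%E) _.
  apply: content_sub_fsum => //; first exact: finite_finset.
    move=> A _; rewrite /S; case: ifP => _; last exact: rej_meas.
    exact: alg_query_measurable.
  move=> w /= rejw; exists (alg_query t w) => //; rewrite /S.
  case: asboolP => //= nc; have [_ agree] := eP _ nc.
  by rewrite -(alg_local agree).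
rewrite fsbig_finType -sumEFin [X in (_ <= X)%E]big_mkcond.
apply: lee_sum => A _; rewrite /S; case: asboolP => /= c.
  by rewrite query_probE.
have [fr _] := eP _ c.
rewrite (_ : [set _ | _]%classic = ~` [set w | alg_accept t w (e A)])%classic.
  by rewrite probability_setC ?acc ?subee //; apply: alg_accept_measurable.
by apply/seteqP; split=> w /= /negP.
Qed.

(** Exchange the sums over inputs and query sets: the expected number of hit inputs is at least two
    thirds of [#|I|], and a set of size at most [q] with the most hits is no worse than the
    average. *)
Lemma exists_hitting_set (q : nat) (I : finType) (F : I -> 'I_n -> R) :
  query_bound t q -> (forall i, eps_far p eps (F i)) ->
  exists2 A : {set 'I_n}, (#|A| <= q)%N &
    (2 * #|I| <= 3 * #|[set i | `[< copy_in p (F i) A >]]%SET|)%N.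
Proof.
move=> qb far; pose hits A := #|[set i | `[< copy_in p (F i) A >]]%SET|.
have P0 : (#|(finset.set0 : {set 'I_n})| <= q)%N by rewrite cards0.
case: (@arg_maxnP _ finset.set0 (fun A : {set 'I_n} => #|A| <= q)%N hits P0).
move=> A Aq Amax.
exists A => //; rewrite -/(hits A) -(ler_nat R) !natrM.
suff : 2 / 3 * #|I|%:R <= (hits A)%:R :> R by lra.
have -> : 2 / 3 * #|I|%:R = \sum_(i : I) (2 / 3) :> R.
  by rewrite sumr_const mulr_natr.
apply: le_trans (ler_sum _ (fun i _ => far_hit_prob (far i))) _.
under eq_bigr do rewrite big_mkcond.
have -> : (hits A)%:R = \sum_B (hits A)%:R * query_prob B.
  by rewrite -mulr_sumr sum_query_prob mulr1.
rewrite exchange_big /=.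
apply: ler_sum => B _.
rewrite -big_mkcond /= sumr_const -[X in X <= _]mulr_natl.
have [Bq|qB] := leqP #|B| q.
  apply: ler_wpM2r; first by rewrite fine_ge0.
  rewrite ler_nat; apply: leq_trans (Amax B Bq).
  by apply: eq_leq; apply: eq_card => i; rewrite !inE.
suff -> : query_prob B = 0 by rewrite !mulr0.
rewrite /query_prob (_ : [set _ | _]%classic = set0%classic) ?measure0 //.
apply/seteqP; split=> // w /= E.
by have := qb w; rewrite E leqNgt qB.
Qed.

End Averaging.

(** * Locating positions in the parts of a signed partition *)

Section Parts.
Variables (k : nat) (p : 'S_k) (P : signed_partition p).

Lemma sp_cut_ge (i : nat) : (i <= sp_size P)%N -> (i <= sp_cut P i)%N.
Proof.
elim: i => // i IH il; apply: leq_ltn_trans (IH (ltnW il)) _.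
exact: sp_cut_lt.
Qed.

Lemma sp_size_le : (sp_size P <= k)%N.
Proof. by have := sp_cut_ge (leqnn _); rewrite sp_cut_last. Qed.

Lemma sp_size_gt0 : (0 < k)%N -> (0 < sp_size P)%N.
Proof.
move=> k_gt0; rewrite lt0n; apply/eqP => s0.
by have := sp_cut_last P; rewrite s0 sp_cut_first; lia.
Qed.

Lemma sp_part_ex (a : nat) : (a < k)%N ->
  exists i, [/\ (i < sp_size P)%N, (sp_cut P i <= a)%N & (a < sp_cut P i.+1)%N].
Proof.
rewrite -[X in (_ < X)%N](sp_cut_last P); have := leqnn (sp_size P).
elim: {1 3}(sp_size P) => [|m IH] ml; first by rewrite sp_cut_first.
have [ai _|cut_a lt_a] := ltnP a (sp_cut P m); first exact: IH (ltnW ml) ai.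
by exists m.
Qed.

Lemma sp_part_le (i i' a a' : nat) : (i < sp_size P)%N -> (a <= a')%N ->
  (sp_cut P i <= a)%N -> (a' < sp_cut P i'.+1)%N -> (i <= i')%N.
Proof.
move=> il aa ca ca'; rewrite leqNgt; apply/negP => ii'.
suff : (sp_cut P i'.+1 <= sp_cut P i)%N by lia.
by rewrite sp_cut_le // ii' ltnW.
Qed.

End Parts.

(** * The shifted hard inputs, their copies and their distance from freeness *)

Section HardInput.
Variables (R : realType) (k : nat) (p : 'S_k) (P : signed_partition p).
Variables (n h B : nat).
Hypothesis k_gt1 : (1 < k)%N.
Hypothesis P_unique : unique_sp R P.
Hypothesis h_gt0 : (0 < h)%N.
Hypothesis B_gt0 : (0 < B)%N.

Local Notation l := (sp_size P).
Local Notation D := (2 * (h * B))%N.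

Let k_gt0 : (0 < k)%N := ltnW k_gt1.
Let l_gt0 : (0 < l)%N := sp_size_gt0 P k_gt0.
Let D_gt0 : (0 < D)%N.
Proof. by rewrite !muln_gt0 h_gt0 B_gt0. Qed.

(* [n] consists of l blocks of D chunks of length k; the surplus positions at
   the end repeat the last position of the last block. *)
Definition clamp (x : nat) : nat := minn x (l * D * k).-1.
Definition blk (x : nat) : nat := (clamp x %/ k %/ D)%N.
Definition chunk (x : nat) : nat := (clamp x %/ k %% D)%N.
Definition step (x : nat) : nat :=
  if sp_plus P (blk x) then chunk x else (D.-1 - chunk x)%N.

Section Shifted.
Variable t : nat -> nat.

(* Chunks at the same height in different blocks share a level only if the
   height is a multiple of h; all other chunks have a level of their own and
   are constant. *)
Definition height (x : nat) : nat := (t (blk x) + step x)%N.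
Definition hard_level (x : nat) : nat :=
  (height x * l + if (h %| height x)%N then 0 else blk x)%N.
(** Chunks have length [k] whatever the length of the part, so surplus positions repeat its last
    entry. *)
Definition hard_off (x : nat) : nat :=
  if (h %| height x)%N then minn (clamp x %% k) (sp_len P (blk x)).-1 else 0%N.
Definition hard_input (x : 'I_n) : R :=
  (hard_level x)%:R +
  (entry p (sp_cut P (blk x) + hard_off x))%:R / (2 * k)%:R.

Lemma blk_lt (x : nat) : (blk x < l)%N.
Proof.
rewrite /blk !ltn_divLR // /clamp -mulnA.
have : (0 < l * (D * k))%N by rewrite !muln_gt0 l_gt0 h_gt0 B_gt0 k_gt0.
by rewrite -ltnS; lia.
Qed.

Lemma hard_off_lt (x : nat) : (hard_off x < sp_len P (blk x))%N.
Proof.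
have := sp_len_gt0 (blk_lt x); rewrite /hard_off; case: ifP => // _.
by move=> l0; rewrite gtn_min prednK // leqnn orbT.
Qed.

Lemma hard_levelE (x : nat) : (hard_level x %/ l)%N = height x.
Proof.
rewrite /hard_level divnMDl // divn_small ?addn0 //.
by case: ifP => // _; apply: blk_lt.
Qed.

Lemma hard_level_lt (x x' : nat) : (height x < height x')%N ->
  (hard_level x < hard_level x')%N.
Proof.
move=> lt; rewrite ltnNge; apply/negP => /(leq_div2r l).
by rewrite !hard_levelE leqNgt lt.
Qed.

Lemma hard_lex (x x' : 'I_n) : (x < x')%N ->
  (blk x < blk x')%N \/
  blk x = blk x' /\
  ((if sp_plus P (blk x) then hard_level x < hard_level x'
    else hard_level x' < hard_level x)%N \/
   hard_level x = hard_level x' /\ (hard_off x <= hard_off x')%N).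
Proof.
move=> lt_x.
have cx : (clamp x <= clamp x')%N by rewrite /clamp; lia.
have wx : (clamp x %/ k <= clamp x' %/ k)%N by exact: leq_div2r.
have bx : (blk x <= blk x')%N by exact: leq_div2r.
move: (bx); rewrite leq_eqVlt => /orP[/eqP eb|]; last by left.
right; split=> //.
have ct : (chunk x <= chunk x')%N.
  by move: wx; rewrite (divn_eq (clamp x %/ k) D) (divn_eq (clamp x' %/ k) D)
    -/(blk x) -/(blk x') eb leq_add2l.
have chunk_ub y : (chunk y < D)%N by rewrite ltn_mod.
move: (ct); rewrite leq_eqVlt => /orP[/eqP ec|ltc]; last first.
  left; have := chunk_ub x; have := chunk_ub x'.
  case: ifP => s h1 h2; apply: hard_level_lt; rewrite /height /step -eb s; lia.
have eh : height x = height x' by rewrite /height /step ec eb.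
right; rewrite /hard_level /hard_off eh eb; split=> //; case: ifP => // _.
have ew : (clamp x %/ k = clamp x' %/ k)%N.
  by rewrite (divn_eq (clamp x %/ k) D) (divn_eq (clamp x' %/ k) D)
    -/(blk x) -/(blk x') -/(chunk x) -/(chunk x') eb ec.
have : (clamp x %% k <= clamp x' %% k)%N.
  by move: cx; rewrite {1}(divn_eq (clamp x) k) {1}(divn_eq (clamp x') k) ew leq_add2l.
by lia.
Qed.

Lemma hard_copy (g : 'I_k -> 'I_n) : is_copy p hard_input g ->
  exists2 y, (h %| y)%N &
    forall i, (i < l)%N -> exists a, blk (g a) = i /\ height (g a) = y.
Proof.
move=> gcopy.
have [lev part] := copy_collapse P_unique (fun x : 'I_n => blk_lt x)
  (fun x : 'I_n => hard_off_lt x) (fun=> erefl) hard_lex gcopy.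
pose a0 := Ordinal k_gt0; pose a1 := Ordinal k_gt1.
have hE a : height (g a) = height (g a0) by rewrite -!hard_levelE (lev a a0).
exists (height (g a0)); last first.
  by move=> i /part[a <-]; exists a; rewrite hE.
(* At a height not divisible by [h], a common level determines the block and the offset is 0, so two
   entries of the copy would have equal values. *)
apply: contraT => priv; have := lev a1 a0.
have := @copy_neq R k p n _ g a1 a0 gcopy isT.
rewrite /hard_input /hard_off /hard_level hE (negbTE priv).
by move=> neq /addnI e; rewrite e eqxx in neq.
Qed.

Section Copies.
Hypothesis n_ge : (l * D * k <= n)%N.
Hypothesis t_lt : forall i, (t i < h * B)%N.

Lemma clamp_id (x : nat) : (x < l * D * k)%N -> clamp x = x.
Proof. by rewrite /clamp; lia. Qed.

Lemma blk_pos (i c o : nat) : (i < l)%N -> (c < D)%N -> (o < k)%N ->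
  let x := ((i * D + c) * k + o)%N in
  [/\ (x < l * D * k)%N, blk x = i, chunk x = c & (clamp x %% k)%N = o].
Proof.
move=> il cD ok x.
have xlt : (x < l * D * k)%N.
  apply: (@leq_trans ((i * D + c).+1 * k)); first by rewrite /x mulSn; lia.
  rewrite leq_mul2r; apply/orP; right.
  by apply: (@leq_trans (i.+1 * D)); [rewrite mulSn; lia | rewrite leq_mul2r il orbT].
have xk : (x %/ k = i * D + c)%N by rewrite divnMDl // divn_small // addn0.
split=> //; rewrite /blk /chunk clamp_id ?xk //.
- by rewrite divnMDl // divn_small // addn0.
- by rewrite modnMDl modn_small.
- by rewrite modnMDl modn_small.
Qed.

(** Shifts are below [h * B] and steps fill the range below [2 * (h * B)], so every block reaches
    each height from [h * B] up to, but excluding, [2 * (h * B)]. Quantifying over [f] makes the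
    copy survive all changes away from it. *)
Lemma height_copy (b : nat) : (b < B)%N ->
  exists2 g : 'I_k -> 'I_n,
    (forall f : 'I_n -> R, (forall a, f (g a) = hard_input (g a)) ->
       is_copy p f g) &
    forall a, height (g a) = ((B + b) * h)%N.
Proof.
move=> bB.
have [pt ptP] := boolp.choice (fun a : 'I_k => sp_part_ex P (ltn_ord a)).
(* The step at which the block of [a] reaches the prescribed height; [c] inverts [step] to give the
   chunk. *)
pose s a := ((B + b) * h - t (pt a))%N.
have s_lt a : (s a < D)%N by rewrite /s; have := t_lt (pt a); nia.
pose c a := if sp_plus P (pt a) then s a else (D.-1 - s a)%N.
have c_lt a : (c a < D)%N by rewrite /c; case: ifP => // _; have := D_gt0; lia.
pose o (a : 'I_k) := (a - sp_cut P (pt a))%N.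
have o_len a : (o a < sp_len P (pt a))%N.
  by have [? ? ?] := ptP a; rewrite /o /sp_len; lia.
have o_lt a : (o a < k)%N by rewrite /o; have := ltn_ord a; lia.
have pt_lt a : (pt a < l)%N by case: (ptP a).
have x_lt a : ((pt a * D + c a) * k + o a < n)%N.
  by have [lt _ _ _] := blk_pos (pt_lt a) (c_lt a) (o_lt a); apply: leq_trans lt n_ge.
pose g a : 'I_n := Ordinal (x_lt a).
have gP a : [/\ blk (g a) = pt a, chunk (g a) = c a & (clamp (g a) %% k)%N = o a].
  by have [_ ? ? ?] := blk_pos (pt_lt a) (c_lt a) (o_lt a).
have gh a : height (g a) = ((B + b) * h)%N.
  have [e1 e2 _] := gP a; rewrite /height /step e1 e2 /c.
  have := s_lt a; rewrite /s; have := t_lt (pt a).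
  have : (t (pt a) <= (B + b) * h)%N by have := t_lt (pt a); nia.
  by case: (sp_plus P (pt a)); lia.
have gf a : hard_input (g a) = ((B + b) * h * l)%N%:R + (p a).+1%:R / (2 * k)%:R.
  have [e1 e2 e3] := gP a; rewrite /hard_input /hard_level /hard_off gh.
  rewrite dvdn_mull // addn0 e1 e3.
  have -> : minn (o a) (sp_len P (pt a)).-1 = o a by have := o_len a; lia.
  by rewrite -entry_ord subnKC //; case: (ptP a).
exists g => // f ff; split=> a a'.
  move=> lt_a; have [la ca ca1] := ptP a; have [la' ca' ca1'] := ptP a'.
  have := sp_part_le la (ltnW lt_a) ca ca1'; rewrite leq_eqVlt => /orP[/eqP e|lt_pt].
    rewrite /= /c /s e ltn_add2l /o e; move: ca; rewrite e; lia.
  have : ((pt a * D + c a).+1 * k <= (pt a' * D + c a') * k)%N.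
    rewrite leq_mul2r; apply/orP; right.
    apply: (@leq_trans ((pt a).+1 * D)); first by rewrite mulSn; have := c_lt a; lia.
    by apply: leq_trans (leq_addr _ _); rewrite leq_mul2r lt_pt orbT.
  move=> le; apply: leq_trans (leq_trans _ le) (leq_addr _ _).
  by rewrite mulSn /= [X in (_ < X)%N]addnC ltn_add2l.
by rewrite !ff !gf lt_level_value // ltn_add2l ltnS.
Qed.

(** The [B] copies have different heights, hence are disjoint, and a pattern-free sequence must
    differ somewhere on each. *)
Lemma hard_input_far (eps : R) : eps * n%:R < B%:R -> eps_far p eps hard_input.
Proof.
move=> epsB f free; apply: lt_le_trans epsB _; rewrite ler_nat.
have wit (b : 'I_B) : exists x : 'I_n,
    hard_input x != f x /\ height x = ((B + b) * h)%N.
  have [g gcopy gh] := height_copy (ltn_ord b).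
  have [[a neq]|eq] := pselect (exists a, hard_input (g a) != f (g a)).
    by exists (g a); split.
  case: free; exists g; apply: gcopy => a; apply/eqP; rewrite eq_sym.
  by apply: contraT => neq; case: eq; exists a.
have [w wP] := boolp.choice wit.
have w_inj : injective w.
  move=> b b' e; have [_ h1] := wP b; have [_ h2] := wP b'.
  move: h1; rewrite e h2 => /eqP; rewrite eqn_pmul2r // eqn_add2l => /eqP.
  by move=> eb; apply: val_inj.
rewrite -[X in (X <= _)%N](card_ord B) -cardsT -(card_imset _ w_inj).
apply: subset_leq_card; apply/fintype.subsetP => x /imsetP[b _ ->].
by rewrite inE; case: (wP b).
Qed.

End Copies.
End Shifted.

Definition shift_fun (t : {ffun 'I_l -> 'I_(h * B)}) (i : nat) : nat :=
  oapp (fun j : 'I_l => nat_of_ord (t j)) 0%N (insub i).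

Lemma shift_fun_lt (t : {ffun 'I_l -> 'I_(h * B)}) (i : nat) :
  (shift_fun t i < h * B)%N.
Proof.
by rewrite /shift_fun; case: insub => [j|] /=; rewrite ?ltn_ord // muln_gt0 h_gt0.
Qed.

(* A copy inside A determines all shifts from one point of A in each block
   together with the common height, a multiple of h below 3 h B. *)
Lemma card_hit_shifts (A : {set 'I_n}) :
  (#|[set t | `[< copy_in p (hard_input (shift_fun t)) A >]]%SET|
     <= #|A| ^ l * (3 * B))%N.
Proof.
have T_gt0 : (0 < h * B)%N by rewrite muln_gt0 h_gt0.
(* A shift is the common height minus the step of the chosen point; the [insubd] default only makes
   the map total. *)
pose rec (u : {ffun 'I_l -> 'I_n} * 'I_(3 * B)) : {ffun 'I_l -> 'I_(h * B)} :=
  [ffun i => insubd (Ordinal T_gt0) (u.2 * h - step (u.1 i))%N].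
pose dom := finset.setX [set xs : {ffun 'I_l -> 'I_n} | xs \in ffun_on (mem A)]%SET
  [set: 'I_(3 * B)]%SET.
have -> : (#|A| ^ l * (3 * B))%N = #|dom|.
  rewrite cardsX cardsT card_ord; congr (_ * _)%N.
  by rewrite cardsE card_ffun_on card_ord.
apply: leq_trans (leq_imset_card rec _).
apply: subset_leq_card; apply/fintype.subsetP => t.
rewrite inE => /asboolP[g [gcopy gA]].
have [y /dvdnP[b yE] part] := hard_copy gcopy.
have wit (i : 'I_l) : exists x : 'I_n,
    [/\ x \in A, blk x = i & height (shift_fun t) x = y].
  by have [a [? ?]] := part i (ltn_ord i); exists (g a).
have [xs xsP] := boolp.choice wit.
have step_lt x : (step x < D)%N.
  rewrite /step; have : (chunk x < D)%N by rewrite ltn_mod.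
  by case: ifP => // _; have := D_gt0; lia.
have tE (i : 'I_l) : y = (t i + step (xs i))%N.
  by have [_ e <-] := xsP i; rewrite /height e /shift_fun valK.
have b_lt : (b < 3 * B)%N.
  have := tE (Ordinal l_gt0); have := step_lt (xs (Ordinal l_gt0)).
  by have := ltn_ord (t (Ordinal l_gt0)); rewrite yE; nia.
apply/imsetP; exists ([ffun i => xs i], Ordinal b_lt).
  by rewrite !inE andbT; apply/ffun_onP => i; rewrite ffunE; case: (xsP i).
apply/ffunP => i; rewrite !ffunE /= -yE (tE i) addnK.
by apply: val_inj; rewrite val_insubd ltn_ord.
Qed.

End HardInput.

(** * Extracting roots, choice of parameters and the final estimate *)

Lemma powR_root_le (R : realType) (l : nat) (eps N M : R) :
  (0 < l)%N -> 0 < eps -> 0 < N -> 0 <= M -> N ^+ l <= eps * N * M ^+ l ->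
  eps `^ (- l%:R^-1) * N `^ (1 - l%:R^-1) <= M.
Proof.
move=> l_gt0 eps_gt0 N_gt0 M_ge0 le_M.
have l_neq0 : l%:R != 0 :> R by rewrite pnatr_eq0 -lt0n.
have rootX (x : R) : 0 < x -> (x `^ l%:R^-1) ^+ l = x.
  move=> x_gt0; rewrite -powR_mulrn ?powR_ge0 // -powRrM mulVf //.
  by rewrite powRr1 // ltW.
rewrite powRB; last by apply/implyP => _; rewrite gt_eqF.
rewrite powRN powRr1 ?(ltW N_gt0) //.
rewrite -(@ler_pXn2r _ l) ?nnegrE //; last first.
  by rewrite mulr_ge0 ?divr_ge0 ?invr_ge0 ?powR_ge0 // ltW.
rewrite !(exprMn, exprVn) !rootX // mulrA ler_pdivrMr // ler_pdivrMl //.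
by rewrite (mulrC (M ^+ l)) mulrA.
Qed.

Theorem theorem3p5 (R : realType) (k : nat) (hk : (2 <= k)%N) :
  exists c eps0 : R, 0 < c /\ 0 < eps0 /\
    forall (p : 'S_k) (n : nat) (eps : R),
      0 < eps -> eps <= eps0 -> 1 <= eps * n%:R ->
      forall (d : measure_display) (T : measurableType d)
             (Pr : probability T R) (t : nonadaptive_alg R n T) (q : nat),
        one_sided_test p eps Pr t -> query_bound t q ->
        c * (eps `^ (- (uspn p R)%:R^-1) * n%:R `^ (1 - (uspn p R)%:R^-1))
          <= q%:R.
Proof.
have k2_gt0 : (0 < k ^ 2)%N by rewrite expn_gt0; lia.
(* The second constant ensures [m <= n] below. In the first, [4 * k ^ 2] comes from [n_le] and 9
   from the factor in [hits]. *)
exists (36 * k ^ 2)%N%:R^-1, (4 * k ^ 2)%N%:R^-1.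
have c36 : (0 < 36 * k ^ 2)%N by lia.
have c4 : (0 < 4 * k ^ 2)%N by lia.
rewrite !invr_gt0 !ltr0n c36 c4; do 2!split=> //.
move=> p n eps eps_gt0 eps_le eps_n d T Pr t q test qb.
have [P [<- P_unique]] := uspn_unique R p hk.
have l_gt0 : (0 < sp_size P)%N by apply: sp_size_gt0; exact: ltnW.
have n_gt0 : 0 < n%:R :> R.
  by rewrite lt_neqAle ler0n andbT; apply: contraTneq eps_n => <-; rewrite mulr0 ler10.
(* The least integer above [eps * n]; it is at most twice [eps * n] because [eps * n] is at least
   1. *)
pose B := (Num.truncn (eps * n%:R)).+1.
have eps_n_ge0 : 0 <= eps * n%:R by apply: le_trans eps_n.
have /andP[B_lb B_gt] := truncn_itv eps_n_ge0.
have B_le : B%:R <= 2 * (eps * n%:R) by rewrite /B -natr1; lra.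
pose m := (2 * B * k ^ 2)%N.
have m_le : (m <= n)%N.
  have eps_k : eps * (4 * (k ^ 2)%:R) <= 1.
    by move: eps_le; rewrite -div1r ler_pdivlMr ?ltr0n // natrM.
  rewrite -(ler_nat R) natrM [(2 * B)%:R]natrM.
  apply: (@le_trans _ _ (eps * (4 * (k ^ 2)%:R) * n%:R)); last first.
    by rewrite -[leRHS]mul1r ler_wpM2r // ltW.
  rewrite (_ : _ * n%:R = 2 * (2 * (eps * n%:R)) * (k ^ 2)%:R); last by ring.
  by rewrite ler_wpM2r ?ler0n // ler_wpM2l.
pose h := (n %/ m)%N.
have m_gt0 : (0 < m)%N by rewrite /m; nia.
have h_gt0 : (0 < h)%N by rewrite divn_gt0.
have hm_le : (h * m <= n)%N by exact: leq_trunc_div.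
(* As [h] is at least 1, [n < (h + 1) * m <= 2 * h * m]. *)
have n_le : (n <= 4 * k ^ 2 * (h * B))%N.
  have := ltn_ceil n m_gt0; rewrite -/h mulSn /m; nia.
have n_ge : (sp_size P * (2 * (h * B)) * k <= n)%N.
  by apply: leq_trans hm_le; have := sp_size_le P; rewrite /m expnS expn1; nia.
have B_gt0 : (0 < B)%N by [].
have far (s : {ffun 'I_(sp_size P) -> 'I_(h * B)}) :
    eps_far p eps (@hard_input R k p P n h B (shift_fun s)).
  by apply: hard_input_far => // i; apply: shift_fun_lt.
have [A Aq hits] := exists_hitting_set hk test qb far.
have {}hits : (2 * (h * B) ^ sp_size P <= 9 * B * q ^ sp_size P)%N.
  move: hits; rewrite card_ffun !card_ord => /leq_trans; apply.
  have := card_hit_shifts hk P_unique h_gt0 B_gt0 A.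
  have : (#|A| ^ sp_size P <= q ^ sp_size P)%N by rewrite leq_exp2r.
  by nia.
rewrite mulrC ler_pdivrMr ?ltr0n //.
apply: powR_root_le => //.
have le_n : (n ^ sp_size P <= (4 * k ^ 2) ^ sp_size P * (h * B) ^ sp_size P)%N.
  by rewrite -expnMn leq_exp2r.
(* This moves the factor 9 under the power. The remaining factor 2 cancels against the one in
   [B_le]. *)
have le9 : (9 <= 9 ^ sp_size P)%N by rewrite -[X in (X <= _)%N]expn1 leq_exp2l.
have le_nat : (2 * n ^ sp_size P <= B * (q * (36 * k ^ 2)) ^ sp_size P)%N.
  rewrite (_ : q * (36 * k ^ 2) = 9 * (4 * k ^ 2) * q)%N; last by lia.
  rewrite (expnMn _ q) (expnMn 9).
  apply: (@leq_trans ((4 * k ^ 2) ^ sp_size P * (9 * B * q ^ sp_size P))).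
    apply: (@leq_trans ((4 * k ^ 2) ^ sp_size P * (2 * (h * B) ^ sp_size P))).
      by rewrite mulnCA leq_mul2l.
    by rewrite leq_mul2l hits orbT.
  move: le9; move: (9 ^ _)%N ((4 * k ^ 2) ^ _)%N (q ^ _)%N => W X Z le9.
  have -> : (X * (9 * B * Z) = 9 * (B * X * Z))%N by clear; lia.
  have -> : (B * (W * X * Z) = W * (B * X * Z))%N by clear; lia.
  by rewrite leq_mul2r le9 orbT.
move: le_nat; rewrite -(ler_nat R) natrM natrX natrM natrX natrM.
set M := (q%:R * _) => le_M.
have := ler_wpM2r (_ : 0 <= M ^+ sp_size P) B_le.
by rewrite exprn_ge0 ?mulr_ge0 // => /(_ isT); lra.
Qed.
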